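(* Let $(S_t)$ be a sequence of sets $S_t \subseteq \mathbb{Z}_2^t$, with $t \rightarrow \infty$, such that each $S_t$ contains no non-trivial solutions to the equation $s_1 + s_2 = s'_1 + s'_2$ and $\lambda(\mathrm{Cay}(\mathbb{Z}_2^{t}, S_t)) = o(|S_t|)$. Let $\alpha,\beta,\gamma$ be fixed positive constants. Then for any sets $A, B, C \subseteq \mathbb{Z}_2^{t}$ with $|A| = \alpha |\mathbb{Z}_2^{t}|$, $|B| = \beta |\mathbb{Z}_2^{t}|$ and $|C| = \gamma |\mathbb{Z}_2^{t}|$, the number $T(A, B, C)$ of triples in $H(\mathbb{Z}_2^{t}, S_t)$ with one vertex in each of $A, B$ and $C$ equals $(1 + o(1)) \alpha \beta \gamma |S_t|^3 |\mathbb{Z}_2^{t}|$, where the $o(1)$ term tends to $0$ as $t\to\infty$ uniformly over all such $A,B,C$.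
   Context: For $S\subseteq\mathbb{Z}_2^t$, $\mathrm{Cay}(\mathbb{Z}_2^t,S)$ is the graph on $\mathbb{Z}_2^t$ with $x\sim y$ iff $x+y\in S$; for a regular graph $G$ with adjacency eigenvalues $\lambda_1\ge\dots\ge\lambda_n$, $\lambda(G)=\max_{i\ne1}|\lambda_i|$. A solution of $s_1+s_2=s'_1+s'_2$ in $S$ is trivial if $\{s_1,s_2\}=\{s'_1,s'_2\}$ as multisets. $H(\mathbb{Z}_2^t,S)$ is the $3$-uniform hypergraph on $\mathbb{Z}_2^t$ whose triples are all sets $\{x+s_1,x+s_2,x+s_3\}$ with $x\in\mathbb{Z}_2^t$ and $s_1,s_2,s_3\in S$ distinct. Here $T(A,B,C)$ counts ordered tuples $(a,b,c)\in A\times B\times C$ such that $\{a,b,c\}$ is a triple of the hypergraph. *)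

(* Defs.v *)
From HB Require Import structures.
From mathcomp Require Import all_boot all_order all_algebra.
From mathcomp Require Import all_classical all_reals all_analysis.
From mathcomp Require Import complex.

Set Implicit Arguments.
Unset Strict Implicit.
Unset Printing Implicit Defensive.

Import Order.TTheory GRing.Theory Num.Theory.
Import numFieldNormedType.Exports.

Local Open Scope ring_scope.

Notation Z2 t := 'rV['F_2]_t.

Section Spectrum.
Variable R : realType.

Definition is_spectrum n (M : 'M[R]_n) (s : seq R) : Prop :=
  sorted >=%R s /\ char_poly M = \prod_(z <- s) ('X - z%:P).

(* The eigenvalues of M with multiplicity, in decreasing order. The default
   [::] is only taken by matrices whose spectrum is not real; see
   [spectrumP] below for symmetric matrices. *)
Definition spectrum n (M : 'M[R]_n) : seq R :=
  xget [::] (is_spectrum M : set (seq R)).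

Lemma is_spectrum_uniq n (M : 'M[R]_n) s1 s2 :
  is_spectrum M s1 -> is_spectrum M s2 -> s1 = s2.
Proof.
move=> [ss1 e1] [ss2 e2].
apply: (sorted_eq (leT := >=%R)) => //; first exact: ge_trans.
  by move=> x y; rewrite andbC => /le_anti.
by apply: prod_XsubC_eq; rewrite -e1 -e2.
Qed.

Lemma spectrumP n (M : 'M[R]_n) : M^T = M -> is_spectrum M (spectrum M).
Proof.
move=> sM; rewrite /spectrum; case: xgetP => [s _ //|noS].
exfalso.
pose MC := map_mx (real_complex R) M.
have hMC : MC \is hermsymmx.
  apply/is_hermitianmxP; rewrite expr0 scale1r.
  apply/matrixP=> i j; rewrite !mxE -[in RHS]sM mxE.
  by rewrite /Num.conj /= oppr0.
have nMC := hermitian_normalmx hMC.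
have dR := hermitian_spectral_diag_real hMC.
pose P := spectralmx MC; pose d := spectral_diag MC.
have EMC : MC = invmx P *m diag_mx d *m P := orthomx_spectralP nMC.
have uP : P \in unitmx := spectral_unit MC.
pose s := sort >=%R [seq complex.Re (d 0 i) | i <- enum 'I_n].
apply: (noS s); split.
  by apply: sort_sorted => x y; rewrite orbC le_total.
have cM : char_poly MC = \prod_(i < n) ('X - (d 0 i)%:P).
  have -> : char_poly MC = char_poly (diag_mx d).
    have e : P *m MC = diag_mx d *m P.
      by rewrite EMC !mulmxA mulmxV // mul1mx.
    rewrite /char_poly /char_poly_mx.
    have eP : map_mx polyC P *m ('X%:M - map_mx polyC MC)
            = ('X%:M - map_mx polyC (diag_mx d)) *m map_mx polyC P.
      by rewrite mulmxBr mulmxBl -!map_mxM e scalar_mxC.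
    have := congr1 determinant eP; rewrite !det_mulmx mulrC => /mulIf; apply.
    by rewrite det_map_mx polyC_eq0 -unitfE -unitmxE.
  rewrite char_poly_trig ?diag_mx_is_trig //.
  by apply: eq_bigr => i _; rewrite mxE eqxx mulr1n.
apply: (map_poly_inj (real_complex R)).
rewrite map_char_poly -/MC cM.
rewrite (perm_big _ (permEl (perm_sort _ _))) /= big_map big_enum /=.
rewrite rmorph_prod; apply: eq_bigr => i _.
rewrite rmorphB /= map_polyX map_polyC /=.
congr (_ - _%:P).
have /mxOverP /(_ 0 i) := dR.
by move=> /RRe_real; rewrite -/d => <-.
Qed.

Variable V : finType.

Definition adjmx (e : rel V) : 'M[R]_#|V| :=
  \matrix_(i, j) (e (enum_val i) (enum_val j))%:R.

(* The default value 0 of the maximum is harmless: all terms are >= 0. *)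
Definition lambda (e : rel V) : R :=
  \big[Num.max/0]_(z <- behead (spectrum (adjmx e))) `|z|.

End Spectrum.

Section Cayley.
Variable t : nat.
Implicit Types (S A B C : {set Z2 t}).

(* A loop at every vertex is present when 0 is in S. *)
Definition cay S : rel (Z2 t) := fun x y => x + y \in S.

(* Besides the solutions with {s1, s2} = {s1', s2'} as multisets, the identities
   s + s = 0 = s' + s', which hold for all s and s' in characteristic 2, count
   as trivial: otherwise no set with two elements would be free of non-trivial
   solutions. *)
Definition trivial_solution (s1 s2 s1' s2' : Z2 t) : Prop :=
  perm_eq [:: s1; s2] [:: s1'; s2'] \/ (s1 = s2 /\ s1' = s2').

Definition no_nontrivial_solution S : Prop :=
  forall s1 s2 s1' s2', s1 \in S -> s2 \in S -> s1' \in S -> s2' \in S ->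
    s1 + s2 = s1' + s2' -> trivial_solution s1 s2 s1' s2'.

Definition hyperH S : {set {set Z2 t}} :=
  [set E : {set Z2 t} | [exists x : Z2 t,
     exists s1 in S, exists s2 in S, exists s3 in S,
       uniq [:: s1; s2; s3] && (E == [set x + s1; x + s2; x + s3]%SET)]]%SET.

Definition Tcount S A B C : nat :=
  #|[set p : Z2 t * Z2 t * Z2 t |
      [&& p.1.1 \in A, p.1.2 \in B, p.2 \in C &
          [set p.1.1; p.1.2; p.2]%SET \in hyperH S]]%SET|.

End Cayley.

(* Main.v *)
(** The characters [chi u] of Z_2^t diagonalise the adjacency matrix of
    Cay(Z_2^t, S), with eigenvalues the Fourier coefficients of the indicator of
    S; the largest one is |S|, attained at u = 0, so all others are bounded by
    lambda in absolute value.  By Parseval, |(x + S) n A| deviates from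
    alpha |S| by at most lambda on average over x.

    The Sidon property says that a triple of the hypergraph determines its
    centre x and s1, s2, s3, so T(A, B, C) is, up to the 3 |S|^2 choices per
    centre with coinciding s_i, the sum over x of
    |(x + S) n A| |(x + S) n B| |(x + S) n C|.  Hence T differs from
    alpha beta gamma |S|^3 N by at most 3 |S|^2 (1 + lambda) N.  Finally Parseval
    for S gives N |S| <= |S|^2 + N lambda^2, so that lambda = o(|S|) forces |S|
    to be either 0 or large, and the error term is negligible. *)

Require Import Defs.
From mathcomp Require Import all_boot all_order all_algebra.
From mathcomp Require Import all_classical all_reals all_analysis.
From mathcomp Require Import ring lra.
Import Order.TTheory GRing.Theory Num.Theory.
Import numFieldNormedType.Exports.
Local Open Scope ring_scope.

Set Implicit Arguments.
Unset Strict Implicit.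
Unset Printing Implicit Defensive.

Lemma lambda_ge0 (R : realType) (V : finType) (e : rel V) : 0 <= lambda R e.
Proof.
rewrite /lambda; elim: (behead _) => [|z s ih]; first by rewrite big_nil.
by rewrite big_cons le_max ih orbT.
Qed.

(** * Characters and Fourier transform on Z_2^t *)

Section Fourier.
Variables (R : realType) (t : nat).
Implicit Types (u v x y : Z2 t) (f g : Z2 t -> R).

Lemma Z2_addxx x : x + x = 0.
Proof. by apply/rowP => i; rewrite !mxE; apply/val_inj; case: (x 0 i) => [[|[|[]]]]. Qed.

Lemma Z2_addKx x y : x + (x + y) = y.
Proof. by rewrite addrA Z2_addxx add0r. Qed.

(** The exponent is the representative 0 or 1 of the pairing of [u] and [x], read as a natural
    number. *)
Definition chi u x : R := (-1) ^+ ((u *m x^T) 0 0 : 'F_2).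

Lemma chiC u x : chi u x = chi x u.
Proof. by rewrite /chi -[in LHS](trmxK u) -trmx_mul mxE. Qed.

Lemma sign_F2D (a b : 'F_2) : (-1) ^+ (a + b)%R = (-1) ^+ a * (-1) ^+ b :> R.
Proof.
by case: a => [[|[|[]]]] //= ?; case: b => [[|[|[]]]] //= ?;
  rewrite ?expr0 ?expr1 ?mulr1 ?mul1r ?mulrNN ?mulr1.
Qed.

Lemma chiDr u x y : chi u (x + y) = chi u x * chi u y.
Proof. by rewrite /chi linearD mulmxDr mxE sign_F2D. Qed.

Lemma chiDl u v x : chi (u + v) x = chi u x * chi v x.
Proof. by rewrite chiC chiDr !(chiC x). Qed.

Lemma chi0r u : chi u 0 = 1.
Proof. by rewrite /chi trmx0 mulmx0 mxE expr0. Qed.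

Lemma chi0l x : chi 0 x = 1.
Proof. by rewrite chiC chi0r. Qed.

Lemma normr_chi u x : `|chi u x| = 1.
Proof. by rewrite normr_sign. Qed.

Lemma chi_neg u : u != 0 -> exists x, chi u x = -1.
Proof.
move=> /eqP u0; have [i ui] : exists i, u 0 i != 0.
  apply/existsP; apply: contra_notT u0 => /existsPn h.
  by apply/rowP => i; rewrite mxE; apply/eqP; have := h i; rewrite negbK.
exists (delta_mx 0 i); rewrite /chi trmx_delta -colE mxE.
by move: ui; case: (u 0 i) => [[|[|[]]]] //= ? _; rewrite expr1.
Qed.

Lemma sum_chi u : \sum_x chi u x = (u == 0)%:R * #|Z2 t|%:R.
Proof.
case: eqVneq => [->|/chi_neg[y hy]].
  by rewrite mul1r; under eq_bigr do rewrite chi0l; rewrite sumr_const.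
rewrite mul0r; set s := LHS.
(* Translation by [y] permutes the group and multiplies every term by -1. *)
have : s = - s.
  rewrite {1}/s (reindex_inj (addIr y)) /= -sumrN.
  by apply: eq_bigr => x _; rewrite chiDr hy mulrN1.
move=> ?; lra.
Qed.

Definition fourier f u : R := \sum_x f x * chi u x.

(** Expanding the square and summing over [u] first, orthogonality of characters leaves only the
    diagonal. The factor [#|Z2 t|] appears because [fourier] is not normalised. *)
Lemma parseval f : \sum_u fourier f u ^+ 2 = #|Z2 t|%:R * \sum_x f x ^+ 2.
Proof.
under eq_bigr => u _ do rewrite expr2 /fourier mulr_suml;
  under eq_bigr => u _ do under eq_bigr => x _ do rewrite mulr_sumr.
rewrite exchange_big mulr_sumr; apply: eq_bigr => x _ /=.
rewrite exchange_big /= (bigD1 x) //= [X in _ + X]big1 ?addr0 => [|y yx].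
  transitivity (\sum_(u : Z2 t) f x ^+ 2); last by rewrite sumr_const mulr_natl.
  apply: eq_bigr => u _.
  by rewrite mulrACA -chiDr Z2_addxx chi0r mulr1 expr2.
transitivity (\sum_u f x * f y * chi (x + y) u).
  by apply: eq_bigr => u _; rewrite mulrACA -chiDr chiC.
rewrite -mulr_sumr sum_chi; case: eqP => [xy|_]; last by rewrite mul0r mulr0.
by case/eqP: yx; rewrite -[y](Z2_addKx x) xy addr0.
Qed.

Definition ind (S : {set Z2 t}) x : R := (x \in S)%:R.

Lemma fourier_indE (S : {set Z2 t}) u : fourier (ind S) u = \sum_(s in S) chi u s.
Proof.
rewrite [RHS]big_mkcond; apply: eq_bigr => x _.
by rewrite /ind; case: (x \in S); rewrite ?mul1r ?mul0r.
Qed.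

Lemma fourier_ind0 (S : {set Z2 t}) : fourier (ind S) 0 = #|S|%:R.
Proof.
by rewrite fourier_indE; under eq_bigr do rewrite chi0l; rewrite sumr_const.
Qed.

Lemma sum_ind_sqr (S : {set Z2 t}) : \sum_x ind S x ^+ 2 = #|S|%:R.
Proof.
rewrite -fourier_ind0; apply: eq_bigr => x _.
by rewrite chi0l mulr1 /ind; case: (x \in S); rewrite ?expr1n ?expr0n.
Qed.

Lemma fourier_ind_le (S : {set Z2 t}) u : fourier (ind S) u <= #|S|%:R.
Proof.
rewrite fourier_indE -sumr_const; apply: ler_sum => s _.
by apply: le_trans (ler_norm _) _; rewrite normr_chi.
Qed.

(** Neighbours are recorded by their differences from [x], so that triples of them are triples of
    elements of [S]. *)
Definition neighbors (S A : {set Z2 t}) x : {set Z2 t} := [set s in S | x + s \in A]%SET.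

Definition deg (S A : {set Z2 t}) x : R := #|neighbors S A x|%:R.

Lemma degE (S A : {set Z2 t}) x : deg S A x = \sum_(s in S) ind A (x + s).
Proof.
rewrite /deg -sumr_const big_mkcond [RHS]big_mkcond.
apply: eq_bigr => s _; rewrite !inE /ind; by case: (s \in S); case: (_ \in A).
Qed.

(** In characteristic 2, [deg S A] is the convolution of the two indicators. *)
Lemma fourier_deg (S A : {set Z2 t}) u :
  fourier (deg S A) u = fourier (ind S) u * fourier (ind A) u.
Proof.
rewrite fourier_indE mulr_suml /fourier.
under eq_bigr => x _ do rewrite degE mulr_suml.
rewrite exchange_big; apply: eq_bigr => s _ /=.
rewrite mulr_sumr (reindex_inj (addIr s)) /=; apply: eq_bigr => x _.
by rewrite -addrA Z2_addxx addr0 chiDr mulrA mulrC.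
Qed.

(** * Spectrum of the Cayley graph *)

Lemma big_enum_val_type (T : finType) (U : Type) (idx : U)
    (op : Monoid.com_law idx) (F : T -> U) :
  \big[op/idx]_(i < #|T|) F (enum_val i) = \big[op/idx]_x F x.
Proof. by rewrite [RHS](reindex _ (onW_bij _ (enum_val_bij T))). Qed.

(** The character table [P] squares to a nonzero scalar matrix, hence is invertible, and it
    conjugates the adjacency matrix to the diagonal matrix of Fourier coefficients. *)
Lemma char_poly_cay (S : {set Z2 t}) :
  char_poly (adjmx R (cay S)) = \prod_u ('X - (fourier (ind S) u)%:P).
Proof.
set M := adjmx R (cay S).
pose P : 'M[R]_#|Z2 t| := \matrix_(i, j) chi (enum_val i) (enum_val j).
pose d : 'rV[R]_#|Z2 t| := \row_i fourier (ind S) (enum_val i).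
have uP : P \in unitmx.
  have PP : P *m P = #|Z2 t|%:R%:M.
    apply/matrixP => i j; rewrite !mxE.
    under eq_bigr => k _ do rewrite !mxE (chiC _ (enum_val j)) -chiDl.
    rewrite (big_enum_val_type _ (chi (enum_val i + enum_val j))) sum_chi.
    rewrite -(inj_eq (addrI (enum_val i))) Z2_addKx addr0 (inj_eq enum_val_inj).
    by rewrite eq_sym; case: eqP => _; rewrite ?mul1r ?mul0r.
  have /mulmx1_unit[] // : P *m (#|Z2 t|%:R^-1 *: P) = 1%:M.
  rewrite -scalemxAr PP scale_scalar_mx mulVf //.
  by rewrite pnatr_eq0 -lt0n; apply/card_gt0P; exists 0.
have e : P *m M = diag_mx d *m P.
  apply/matrixP => i j; rewrite mul_diag_mx !mxE.
  under eq_bigr => k _ do rewrite !mxE.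
  rewrite (big_enum_val_type _
    (fun x => chi (enum_val i) x * (cay S x (enum_val j))%:R)).
  rewrite (reindex_inj (addIr (enum_val j))) mulr_suml.
  apply: eq_bigr => x _; rewrite /cay -addrA Z2_addxx addr0 chiDr /ind.
  by rewrite mulrAC [chi _ x * _]mulrC.
have -> : char_poly M = char_poly (diag_mx d).
  rewrite /char_poly /char_poly_mx.
  have eP : map_mx polyC P *m ('X%:M - map_mx polyC M)
          = ('X%:M - map_mx polyC (diag_mx d)) *m map_mx polyC P.
    by rewrite mulmxBr mulmxBl -!map_mxM e scalar_mxC.
  (* The determinant of [P] is a nonzero constant polynomial and cancels. *)
  have := congr1 determinant eP; rewrite !det_mulmx mulrC => /mulIf; apply.
  by rewrite det_map_mx polyC_eq0 -unitfE -unitmxE.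
rewrite char_poly_trig ?diag_mx_is_trig //.
rewrite -(big_enum_val_type _ (fun u => 'X - (fourier (ind S) u)%:P)).
by apply: eq_bigr => i _; rewrite !mxE eqxx mulr1n.
Qed.

Lemma spectrum_cay (S : {set Z2 t}) :
  perm_eq (spectrum (adjmx R (cay S))) [seq fourier (ind S) u | u <- enum (Z2 t)].
Proof.
have [|_ e] := spectrumP (M := adjmx R (cay S)).
  by apply/matrixP => i j; rewrite !mxE /cay addrC.
by apply: prod_XsubC_eq; rewrite -e char_poly_cay big_map big_enum.
Qed.

(** [lambda] discards one entry of the sorted spectrum. The coefficient at 0 is |S| and bounds all
    others, so the discarded value is |S|; removing one copy of it leaves the coefficients at all
    [u != 0] in the tail, even those equal to |S|. *)
Lemma fourier_le_lambda (S : {set Z2 t}) u : u != 0 ->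
  `|fourier (ind S) u| <= lambda R (cay S).
Proof.
move=> u0; have hp := spectrum_cay S; rewrite /lambda.
have [|so _] := spectrumP (M := adjmx R (cay S)).
  by apply/matrixP => i j; rewrite !mxE /cay addrC.
case: (spectrum _) so hp => [|z s] so hp.
  by have := perm_mem hp (fourier (ind S) u); rewrite map_f ?mem_enum.
have zE : z = #|S|%:R.
  apply/le_anti/andP; split.
    have : z \in [seq fourier (ind S) u | u <- enum (Z2 t)].
      by rewrite -(perm_mem hp) mem_head.
    by case/mapP => v _ ->; exact: fourier_ind_le.
  have : #|S|%:R \in z :: s.
    by rewrite (perm_mem hp) -fourier_ind0 map_f ?mem_enum.
  rewrite inE => /predU1P[-> //|hs].
  by have /(order_path_min ge_trans)/allP/(_ _ hs) := so.
suff us : fourier (ind S) u \in s.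
  rewrite /=; elim: s us {so hp} => // y s ih; rewrite inE big_cons le_max.
  by case/predU1P => [->|/ih ->]; rewrite ?lexx ?orbT.
have h0 : (0 : Z2 t) \in enum (Z2 t) by rewrite mem_enum.
have := perm_trans hp (perm_map (fourier (ind S)) (perm_to_rem h0)).
rewrite /= fourier_ind0 zE perm_cons => /perm_mem ->; apply: map_f.
by rewrite mem_rem_uniq ?enum_uniq // inE mem_enum u0.
Qed.

(** * Estimates in terms of the second eigenvalue *)

Lemma expander_mixing (S A : {set Z2 t}) (a : R) : #|A|%:R = a * #|Z2 t|%:R ->
  \sum_x (deg S A x - a * #|S|%:R) ^+ 2 <= lambda R (cay S) ^+ 2 * #|A|%:R.
Proof.
move=> hA; have N0 : 0 < #|Z2 t|%:R :> R.
  by rewrite ltr0n; apply/card_gt0P; exists 0.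
rewrite -(ler_pM2l N0) -parseval mulrCA -(sum_ind_sqr A) -parseval mulr_sumr.
apply: ler_sum => u _.
(* Subtracting the mean kills the coefficient at 0 and changes no other; those are coefficients of
   [ind A] scaled by at most [lambda]. *)
have -> : fourier (fun x => deg S A x - a * #|S|%:R) u =
    fourier (deg S A) u - a * #|S|%:R * ((u == 0)%:R * #|Z2 t|%:R).
  rewrite -sum_chi mulr_sumr -sumrB; apply: eq_bigr => x _.
  by rewrite mulrBl.
rewrite fourier_deg; case: eqVneq => [->|u0].
  rewrite !fourier_ind0 hA mul1r.
  rewrite [X in X ^+ 2](_ : _ = 0); last by ring.
  by rewrite expr0n mulr_ge0 ?sqr_ge0.
rewrite mul0r mulr0 subr0 exprMn ler_wpM2r ?sqr_ge0 //.
rewrite -[X in X <= _]real_normK ?num_real // lerXn2r ?nnegrE ?fourier_le_lambda //.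
exact: lambda_ge0.
Qed.

(** Parseval for [ind S]: the frequency 0 contributes |S|^2 and every other one at most [lambda]
    squared. *)
Lemma card_le_lambda (S : {set Z2 t}) :
  #|Z2 t|%:R * #|S|%:R <= #|S|%:R ^+ 2 + #|Z2 t|%:R * lambda R (cay S) ^+ 2.
Proof.
rewrite -[X in _ * X <= _]sum_ind_sqr -parseval (bigD1 0) //= fourier_ind0 lerD2l.
apply: (@le_trans _ _ (\sum_(u : Z2 t) lambda R (cay S) ^+ 2)).
  rewrite big_mkcond; apply: ler_sum => u _; case: ifP => u0; last exact: sqr_ge0.
  rewrite -[X in X <= _]real_normK ?num_real // lerXn2r ?nnegrE ?fourier_le_lambda //.
  exact: lambda_ge0.
by rewrite sumr_const mulr_natl.
Qed.

End Fourier.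

(** A form of Cauchy-Schwarz, read off from the sum of [(|h x| - l) ^+ 2] being nonnegative. The
    case [l = 0] is separate because the resulting inequality is divided by [l]. *)
Lemma sum_norm_le (R : realType) (T : finType) (h : T -> R) (l : R) : 0 <= l ->
  \sum_x h x ^+ 2 <= l ^+ 2 * #|T|%:R -> \sum_x `|h x| <= l * #|T|%:R.
Proof.
rewrite le_eqVlt => /predU1P[<-|l0] hl.
  rewrite mul0r big1 // => x _; apply/eqP; rewrite normr_eq0 -sqrf_eq0.
  have /psumr_eq0P -> // : \sum_x h x ^+ 2 = 0.
    apply/le_anti/andP; split; last by apply: sumr_ge0 => y _; exact: sqr_ge0.
    by move: hl; rewrite expr0n mul0r.
  by move=> y _; exact: sqr_ge0.
have : 0 <= \sum_x (`|h x| - l) ^+ 2 by apply: sumr_ge0 => x _; exact: sqr_ge0.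
have -> : \sum_x (`|h x| - l) ^+ 2 =
    \sum_x h x ^+ 2 - 2 * l * \sum_x `|h x| + l ^+ 2 * #|T|%:R.
  have -> : l ^+ 2 * #|T|%:R = \sum_(x : T) l ^+ 2 by rewrite sumr_const mulr_natr.
  rewrite mulr_sumr -sumrB -big_split; apply: eq_bigr => x _ /=.
  by rewrite -[h x ^+ 2]real_normK ?num_real //; ring.
by move=> h1; rewrite -(ler_pM2l l0); nra.
Qed.

(** Makes distinctness a property of the set, so that it passes between two listings of one
    triple. *)
Lemma card_set3 (T : finType) (a b c : T) :
  (#|[set a; b; c]%SET| == 3) = uniq [:: a; b; c].
Proof.
have -> : [set a; b; c]%SET = [set x in [:: a; b; c]]%SET.
  by apply/setP => x; rewrite !inE orbA.
by rewrite cardsE; apply/eqP/idP => /card_uniqP.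
Qed.

(** * Counting triples by their centres *)

Section Count.
Variable t : nat.
Implicit Types (S A B C : {set Z2 t}).

Definition star_box S A B C (x : Z2 t) : {set Z2 t * Z2 t * Z2 t} :=
  finset.setX (finset.setX (neighbors S A x) (neighbors S B x)) (neighbors S C x).

Definition star_triples S A B C (x : Z2 t) : {set Z2 t * Z2 t * Z2 t} :=
  [set p in star_box S A B C x | uniq [:: p.1.1; p.1.2; p.2]]%SET.

(** A point of the box with a repeated entry is determined by the position of the repetition ([D1],
    [D2] or [D3]) and two elements of [S]. *)
Lemma star_box_bounds S A B C x :
  (#|star_triples S A B C x| <= #|star_box S A B C x|
     <= #|star_triples S A B C x| + 3 * #|S| ^ 2)%N.
Proof.
apply/andP; split.
  by apply: subset_leq_card; apply/fintype.subsetP => p; rewrite inE => /andP[].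
pose D1 := [set (p.1, p.1, p.2) | p in finset.setX S S]%SET.
pose D2 := [set (p.1, p.2, p.1) | p in finset.setX S S]%SET.
pose D3 := [set (p.1, p.2, p.2) | p in finset.setX S S]%SET.
have hD : star_box S A B C x \subset
    (star_triples S A B C x :|: (D1 :|: (D2 :|: D3)))%SET.
  apply/fintype.subsetP => -[[a b] c] hp; have := hp.
  rewrite !inE /= => /andP[/andP[/andP[aS aA] /andP[bS bB]] /andP[cS cC]].
  rewrite aS aA bS bB cS cC /= andbT.
  case: (eqVneq a b) => [<-|ab] /=.
    apply/orP; right; apply/orP; left; apply/imsetP.
    by exists (a, c); rewrite // inE aS cS.
  case: (eqVneq a c) => [<-|ac] /=.
    do 2!(apply/orP; right); apply/orP; left; apply/imsetP.
    by exists (a, b); rewrite // inE aS bS.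
  case: (eqVneq b c) => [<-|bc] /=; last first.
    by rewrite /in_mem /= !orbF negb_or ab ac bc.
  do 3!(apply/orP; right); apply/imsetP.
  by exists (a, b); rewrite // inE aS bS.
apply: leq_trans (subset_leq_card hD) _.
apply: leq_trans (leq_card_setU _ _) _; rewrite leq_add2l.
have hS : #|finset.setX S S| = (#|S| ^ 2)%N by rewrite cardsX.
apply: leq_trans (leq_card_setU _ _) _; rewrite mulSn.
apply: leq_add; first by rewrite -hS leq_imset_card.
apply: leq_trans (leq_card_setU _ _) _; rewrite mulSn mul1n.
by apply: leq_add; rewrite -hS leq_imset_card.
Qed.

(** Distinctness of [s1] and [s2] excludes the solutions [s + s = s' + s'] that [trivial_solution]
    admits. *)
Lemma sidon_pair S s1 s2 s1' s2' : no_nontrivial_solution S ->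
  s1 \in S -> s2 \in S -> s1' \in S -> s2' \in S -> s1 != s2 ->
  s1 + s2 = s1' + s2' -> (s1 = s1' /\ s2 = s2') \/ (s1 = s2' /\ s2 = s1').
Proof.
move=> hS h1 h2 h1' h2' ne e.
have [p|[] /eqP] := hS _ _ _ _ h1 h2 h1' h2' e; last by rewrite (negPf ne).
have := perm_mem p s1; have := perm_mem p s2; rewrite !inE !eqxx orbT /=.
move=> /esym/orP[]/eqP e2 /esym/orP[]/eqP e1; [|by right|by left|];
  by move: ne; rewrite e1 e2 eqxx.
Qed.

(** The map [f] from centres with labels in [S] to ordered triples of vertices is injective by the
    Sidon property, and its image is what [Tcount] counts. *)
Lemma Tcount_star S A B C : no_nontrivial_solution S ->
  Tcount S A B C = (\sum_(x : Z2 t) #|star_triples S A B C x|)%N.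
Proof.
move=> hS.
pose Q := [set q : Z2 t * (Z2 t * Z2 t * Z2 t) | q.2 \in star_triples S A B C q.1]%SET.
pose f (q : Z2 t * (Z2 t * Z2 t * Z2 t)) :=
  (q.1 + q.2.1.1, q.1 + q.2.1.2, q.1 + q.2.2).
have -> : (\sum_(x : Z2 t) #|star_triples S A B C x|)%N = #|Q|.
  rewrite -sum1_card (eq_bigl (fun q => predT q.1 && (q.2 \in star_triples S A B C q.1))).
    rewrite -(pair_big_dep predT (fun x p => p \in star_triples S A B C x) (fun _ _ => 1%N)).
    by apply: eq_bigr => x _; rewrite sum1_card.
  by move=> q; rewrite inE.
have memQ x a b c : ((x, (a, b, c)) \in Q) =
  [&& a \in S, b \in S, c \in S, uniq [:: a; b; c],
      x + a \in A, x + b \in B & x + c \in C].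
  rewrite !inE /=.
  by case: (a \in S); case: (b \in S); case: (c \in S); rewrite ?andbF //= ?andbT;
   case: (x + a \in A); case: (x + b \in B); case: (x + c \in C); rewrite ?andbF ?andbT.
have fi : {in Q &, injective f}.
  move=> [x [[a b] c]] [y [[a' b'] c']]; rewrite !memQ.
  case/and5P=> aS bS cS; rewrite /= !inE negb_or andbT => /andP[/andP[ab ac] bc] _.
  case/and5P=> aS' bS' cS' _ _ [] /= ea eb ec.
  (* Adding two of the vertex equations eliminates both centres. *)
  have pair p q p' q' : x + p = y + p' -> x + q = y + q' -> p + q = p' + q'.
    move=> e1 e2; rewrite -[p](Z2_addKx x) -[q](Z2_addKx x) e1 e2.
    by rewrite addrACA Z2_addxx add0r addrACA Z2_addxx add0r.
  have aa' : a = a'.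
    (* If neither pair gives [a = a'], both are swapped, and then [b = a' = c]. *)
    have [[] //|[_ ba]] := sidon_pair hS aS bS aS' bS' ab (pair _ _ _ _ ea eb).
    have [[] //|[_ ca]] := sidon_pair hS aS cS aS' cS' ac (pair _ _ _ _ ea ec).
    by move: bc; rewrite ba ca eqxx.
  have xy : x = y by apply: (addIr a); rewrite ea aa'.
  by move: ea eb ec; rewrite xy => /addrI-> /addrI-> /addrI->.
rewrite -(card_in_imset fi) /Tcount; apply: eq_card => -[[a b] c].
rewrite inE /=; apply/idP/imsetP.
  case/and4P=> aA bB cC; rewrite inE.
  case/existsP=> x /exists_inP[s1 h1] /exists_inP[s2 h2] /exists_inP[s3 h3].
  case/andP=> us /eqP e.
  (* The listing [a, b, c] may permute [x + s1, x + s2, x + s3], so the labels are recomputed from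
     the vertices. *)
  exists (x, (x + a, x + b, x + c)); last by rewrite /f /= !Z2_addKx.
  rewrite memQ !Z2_addKx aA bB cC !andbT.
  have inS y : y \in [set a; b; c]%SET -> x + y \in S.
    by rewrite e !inE => /orP[/orP[]|] /eqP ->; rewrite Z2_addKx.
  rewrite !inS ?inE ?eqxx ?orbT //=.
  have := card_set3 a b c; rewrite e.
  have -> : #|[set x + s1; x + s2; x + s3]%SET| == 3.
    by rewrite card_set3 -[[:: x + s1; _; _]]/(map (+%R x) [:: s1; s2; s3])
      (map_inj_uniq (addrI x)).
  by move/esym; rewrite -(map_inj_uniq (addrI x)).
case=> -[x [[s1 s2] s3]]; rewrite memQ => /and5P[h1 h2 h3 us /and3P[hA hB hC]].
case=> -> -> ->; rewrite hA hB hC /= inE; apply/existsP; exists x.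
apply/exists_inP; exists s1 => //; apply/exists_inP; exists s2 => //.
by apply/exists_inP; exists s3 => //; apply/andP.
Qed.

Lemma Tcount_estimate (R : realType) S A B C (a b c : R) :
  no_nontrivial_solution S -> 0 < a -> 0 < b ->
  #|A|%:R = a * #|Z2 t|%:R -> #|B|%:R = b * #|Z2 t|%:R ->
  #|C|%:R = c * #|Z2 t|%:R ->
  `|(Tcount S A B C)%:R - a * b * c * #|S|%:R ^+ 3 * #|Z2 t|%:R|
    <= 3 * #|S|%:R ^+ 2 * (1 + lambda R (cay S)) * #|Z2 t|%:R.
Proof.
move=> hS a0 b0 hA hB hC; have l0 := lambda_ge0 R (cay S).
set d : R := #|S|%:R; set N : R := #|Z2 t|%:R; set l := lambda R (cay S).
have N0 : 0 < N by rewrite ltr0n; apply/card_gt0P; exists 0.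
have density_le1 (E : {set Z2 t}) (e : R) : #|E|%:R = e * N -> e <= 1.
  by move=> hE; rewrite -(ler_pM2r N0) -hE mul1r ler_nat max_card.
have deviation (E : {set Z2 t}) (e : R) : #|E|%:R = e * N ->
    \sum_x `|deg R S E x - e * d| <= l * N.
  move=> hE; apply: sum_norm_le => //.
  apply: le_trans (expander_mixing S hE) _.
  by rewrite ler_wpM2l ?sqr_ge0 // ler_nat max_card.
have deg_bounds E x : 0 <= deg R S E x <= d.
  rewrite ler0n ler_nat subset_leq_card //.
  by apply/fintype.subsetP => s; rewrite inE => /andP[].
have star x : `|#|star_triples S A B C x|%:R - a * b * c * d ^+ 3| <=
    3 * d ^+ 2 + d ^+ 2 * (`|deg R S A x - a * d| + `|deg R S B x - b * d|
                           + `|deg R S C x - c * d|).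
  have /andP[] := star_box_bounds S A B C x.
  rewrite -!(ler_nat R) natrD natrM natrX -/d.
  have -> : #|star_box S A B C x|%:R = deg R S A x * deg R S B x * deg R S C x.
    by rewrite !cardsX !natrM.
  have := deg_bounds A x; have := deg_bounds B x; have := deg_bounds C x.
  have := density_le1 _ _ hA; have := density_le1 _ _ hB.
  set T := _%:R; move: T (deg R S A x) (deg R S B x) (deg R S C x).
  move=> T p q r b1 a1 /andP[r0 rd] /andP[q0 qd] /andP[p0 pd] T1 T2.
  have d0 : 0 <= d by apply: le_trans pd.
  (* Telescoping replaces one degree at a time by its mean; the two remaining factors are each at
     most [d], since densities are at most 1. *)
  have -> : T - a * b * c * d ^+ 3 = (T - p * q * r) +
     ((p - a * d) * (q * r) + (q - b * d) * (a * d * r)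
       + (r - c * d) * (a * d * (b * d))) by ring.
  apply: le_trans (ler_normD _ _) _; apply: lerD.
    by rewrite ler_norml; apply/andP; split; lra.
  apply: le_trans (ler_normD _ _) _; rewrite mulrDr; apply: lerD.
    apply: le_trans (ler_normD _ _) _; rewrite mulrDr; apply: lerD.
      rewrite normrM mulrC ler_wpM2r // ger0_norm ?mulr_ge0 //.
      by rewrite expr2 ler_pM.
    rewrite normrM mulrC ler_wpM2r // ger0_norm ?mulr_ge0 ?(ltW a0) //.
    by rewrite expr2 ler_pM ?mulr_ge0 ?(ltW a0) // ler_piMl.
  rewrite normrM mulrC ler_wpM2r // ger0_norm ?mulr_ge0 ?(ltW a0) ?(ltW b0) //.
  by rewrite expr2 ler_pM ?mulr_ge0 ?(ltW a0) ?(ltW b0) // ler_piMl.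
have -> : (Tcount S A B C)%:R - a * b * c * d ^+ 3 * N =
    \sum_x (#|star_triples S A B C x|%:R - a * b * c * d ^+ 3).
  by rewrite Tcount_star // natr_sum sumrB sumr_const mulr_natr.
apply: le_trans (ler_norm_sum _ _ _) _.
apply: le_trans (ler_sum _ (fun x _ => star x)) _.
rewrite big_split /= sumr_const -[X in X + _]mulr_natr -mulr_sumr !big_split /= -/N.
have := deviation _ _ hA; have := deviation _ _ hB; have := deviation _ _ hC.
set s1 := \sum_x _; set s2 := \sum_x _; set s3 := \sum_x _ => h1 h2 h3.
have -> : 3 * d ^+ 2 * (1 + l) * N = 3 * d ^+ 2 * N + d ^+ 2 * (l * N + l * N + l * N).
  by ring.
by rewrite lerD2l ler_wpM2l ?sqr_ge0 //; lra.
Qed.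
End Count.

(** * Passage to the limit *)

Local Open Scope classical_set_scope.

Theorem theorem1p3 (R : realType) (S : forall t : nat, {set Z2 t})
    (hS : forall t, no_nontrivial_solution (S t))
    (hlambda : (fun t => lambda R (cay (S t)))
                 =o_\oo (fun t => #|S t|%:R : R))
    (alpha beta gamma : R)
    (alpha_gt0 : 0 < alpha) (beta_gt0 : 0 < beta) (gamma_gt0 : 0 < gamma) :
  forall eps : R, 0 < eps ->
    \forall t \near \oo, forall A B C : {set Z2 t},
      #|A|%:R = alpha * #|Z2 t|%:R ->
      #|B|%:R = beta * #|Z2 t|%:R ->
      #|C|%:R = gamma * #|Z2 t|%:R ->
      exists2 delta : R, `|delta| <= eps &
        (Tcount (S t) A B C)%:R =
          (1 + delta) * (alpha * beta * gamma * #|S t|%:R ^+ 3 * #|Z2 t|%:R).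
Proof.
move=> eps eps0.
have m0 : 0 < alpha * beta * gamma by rewrite !mulr_gt0.
set m := alpha * beta * gamma in m0 *.
(* [k <= 1 / 2] gives [k ^+ 2 <= k / 2], which bounds [d] from below in [kd]. *)
pose k : R := Num.min (eps * m / 6) (1 / 2).
have k0 : 0 < k by rewrite lt_min !divr_gt0 ?mulr_gt0.
have [k1 k2] : k <= eps * m / 6 /\ k <= 1 / 2.
  by split; rewrite ge_min lexx ?orbT.
have /eqoP/(_ _ k0) hl := hlambda.
near=> t => A B C hA hB hC.
have lt : lambda R (cay (S t)) <= k * #|S t|%:R.
  have : `|lambda R (cay (S t))| <= k * `|#|S t|%:R : R| by near: t.
  by rewrite !ger0_norm ?lambda_ge0.
(* This follows from [t < 2 ^ t]. The threshold is chosen so that [k * d < 1] would give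
   [2 * d <= N]. *)
have Nt : 2 / k <= #|Z2 t|%:R.
  apply: (@le_trans _ _ t%:R); first by near: t; exact: nbhs_infty_ger.
  by rewrite ler_nat card_mx card_Fp // mul1n ltnW // ltn_expl.
have := Tcount_estimate (hS t) alpha_gt0 beta_gt0 hA hB hC.
have := card_le_lambda R (S t).
have := lambda_ge0 R (cay (S t)).
move: lt Nt (ler0n R #|S t|).
rewrite -/m; set l := lambda _ _; set d : R := #|S t|%:R.
set N : R := #|Z2 t|%:R; set T : R := (Tcount _ _ _ _)%:R => hlt hN d0 l0 hd hT.
have N0 : 0 < N by apply: lt_le_trans hN; rewrite divr_gt0.
move: d0; rewrite le_eqVlt => /predU1P[d0|d0].
  (* For empty [S t] the error bound vanishes, so [T = 0] and the main term is 0 too. *)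
  exists 0; first by rewrite normr0 ltW.
  by move: hT; rewrite -d0 !expr0n /= !(mulr0, mul0r) subr0 normr_le0 => /eqP ->.
(* Otherwise [card_le_lambda], divided by [d], gives [N <= d + N * (k * (k * d))], where the first
   term is at most [N / 2] and the second is smaller than [N / 2]. *)
have kd : 1 <= k * d.
  rewrite leNgt; apply/negP => dk.
  have kN : 2 <= k * N by rewrite mulrC -ler_pdivrMr.
  have dN : 2 * d <= N by rewrite -(ler_pM2l k0); lra.
  have l2 : l ^+ 2 <= (k * d) ^+ 2 by rewrite lerXn2r ?nnegrE // mulr_ge0 // ltW.
  have : N * d <= d ^+ 2 + N * (k * d) ^+ 2.
    by apply: le_trans hd _; rewrite lerD2l ler_wpM2l // ltW.
  have kkd : k * (k * d) < 1 / 2.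
    apply: (@le_lt_trans _ _ (1 / 2 * (k * d))); last by lra.
    by rewrite ler_wpM2r // mulr_ge0 // ltW.
  have : N * (k * (k * d)) < N * (1 / 2) by rewrite ltr_pM2l.
  move=> h1 h2; have : N <= d + N * (k * (k * d)) by rewrite -(ler_pM2r d0); lra.
  by lra.
exists (T / (m * d ^+ 3 * N) - 1); last first.
  by rewrite addrC subrK mulfVK // !mulf_neq0 ?expf_neq0 ?gt_eqF.
have P0 : 0 < m * d ^+ 3 * N by rewrite !mulr_gt0 ?exprn_gt0.
rewrite -(ler_pM2r P0) -[X in _ * X <= _](gtr0_norm P0) -normrM mulrBl mul1r.
rewrite divfK ?gt_eqF //; apply: le_trans hT _.
rewrite [eps * _]mulrA ler_wpM2r ?(ltW N0) //.
have -> : eps * (m * d ^+ 3) = d ^+ 2 * (eps * m * d) by ring.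
have -> : 3 * d ^+ 2 * (1 + l) = d ^+ 2 * (3 * (1 + l)) by ring.
rewrite ler_wpM2l ?sqr_ge0 //.
(* Both 1 and [l] are at most [k * d], so [3 * (1 + l) <= 6 * (k * d)]; this is where the 6 in [k]
   comes from. *)
have : k * d <= eps * m / 6 * d by rewrite ler_wpM2r // ltW.
lra.
Unshelve. all: by end_near.
Qed.
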